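(* There is an algorithm that, given a $(0,2)$-graph $G$ with $n$ vertices and $m$ edges, decides in $O(n+m)$ time whether $G$ is $2$-admissible.
   Context: All graphs are finite and simple. A $(0,2)$-graph is a graph whose vertex set can be partitioned into two cliques. A tree $t$-spanner of a graph $G$ is a spanning tree $T$ of $G$ such that $d_T(u,v)\le t$ for every edge $uv$ of $G$. $G$ is $t$-admissible if it has a tree $t$-spanner. *)

(* Defs.v *)
From mathcomp Require Import all_boot.
Set Implicit Arguments.
Unset Strict Implicit.
Unset Printing Implicit Defensive.

Record sgraph (V : finType) := SGraph {
  edge : rel V;
  edge_sym : symmetric edge;
  edge_irrefl : irreflexive edge
}.

Section Graphs.
Variable V : finType.
Implicit Types (G T : sgraph V) (A : {set V}) (x y : V).

Definition edges G : {set {set V}} :=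
  [set [set u.1; u.2] | u : V * V & edge G u.1 u.2].

Definition clique G A : Prop := {in A &, forall x y, x != y -> edge G x y}.

(* The two parts are allowed to be empty. *)
Definition zero_two_graph G : Prop :=
  exists A : {set V}, clique G A /\ clique G (~: A).

Definition connected G : Prop := forall x y, connect (edge G) x y.

(* A [ucycle] of size 2 is a single edge traversed back and forth. *)
Definition acyclic G : Prop :=
  forall c : seq V, ucycle (edge G) c -> size c < 3.

Definition is_tree G : Prop := connected G /\ acyclic G.

Definition walk G x y (k : nat) : bool :=
  [exists p : k.-tuple V, path (edge G) x p && (last x p == y)].

(* Length of a shortest path; it is less than #|V| when x and y are connected,
   and the junk value #|V| is returned otherwise. *)
Definition dist G x y : nat := find (walk G x y) (iota 0 #|V|).

Definition spanning_tree G T : Prop :=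
  is_tree T /\ subrel (edge T) (edge G).

Definition tree_spanner (t : nat) G T : Prop :=
  spanning_tree G T /\ forall x y, edge G x y -> dist T x y <= t.

Definition admissible (t : nat) G : Prop := exists T, tree_spanner t G T.

End Graphs.

(* Algorithms are programs for a unit-cost word RAM, with structured control
   flow in place of jumps.  A program can name only finitely many registers;
   it accesses the memory by indirect addressing.  Tests compare two
   registers, and every test or instruction takes one step.  Subtraction is
   truncated. *)
Inductive instr :=
  | Const of nat & nat         (* Const r k   : r := k         *)
  | Add of nat & nat & nat     (* Add r s t   : r := s + t     *)
  | Sub of nat & nat & nat     (* Sub r s t   : r := s - t     *)
  | Read of nat & nat          (* Read r s    : r := memory[s] *)
  | Write of nat & nat.        (* Write r s   : memory[r] := s *)

Inductive program :=
  | Skip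
  | Instr of instr
  | Seq of program & program
  | IfLt of nat & nat & program & program
  | WhileLt of nat & nat & program.

Record state := State { reg : nat -> nat; memory : nat -> nat }.

Definition result (i : instr) (s : state) : nat :=
  match i with
  | Const _ k => k
  | Add _ a b => reg s a + reg s b
  | Sub _ a b => reg s a - reg s b
  | Read _ a => memory s (reg s a)
  | Write _ b => reg s b
  end.

Definition step (i : instr) (s : state) : state :=
  let v := result i s in
  match i with
  | Const r _ | Add r _ _ | Sub r _ _ | Read r _ =>
      State [eta reg s with r |-> v] (memory s)
  | Write a _ => State (reg s) [eta memory s with reg s a |-> v]
  end.

(* [exec w p s s' t]: started in s, p halts in s' after t steps, and it writes
   only values below w.  An instruction whose result does not fit in a word has
   no execution. *)
Inductive exec (w : nat) : program -> state -> state -> nat -> Prop :=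
  | ExecSkip s : exec w Skip s s 1
  | ExecInstr i s : result i s < w -> exec w (Instr i) s (step i s) 1
  | ExecSeq p q s1 s2 s3 t u :
      exec w p s1 s2 t -> exec w q s2 s3 u -> exec w (Seq p q) s1 s3 (t + u)
  | ExecIf a b p q s s' t :
      exec w (if reg s a < reg s b then p else q) s s' t ->
      exec w (IfLt a b p q) s s' t.+1
  | ExecWhileStop a b p s :
      reg s b <= reg s a -> exec w (WhileLt a b p) s s 1
  | ExecWhileLoop a b p s1 s2 s3 t u :
      reg s1 a < reg s1 b ->
      exec w p s1 s2 t -> exec w (WhileLt a b p) s2 s3 u ->
      exec w (WhileLt a b p) s1 s3 (t + u).+1.

(* The input occupies the memory from address 0 on; everything else is 0. *)
Definition init_state (input : seq nat) : state :=
  State (fun=> 0) (nth 0 input).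

Definition accepting (s : state) : bool := 0 < reg s 0.

(* Neighbours are listed without repetition, in an arbitrary order. *)
Definition adjacency_lists n (G : sgraph 'I_n) (l : seq (seq nat)) : Prop :=
  size l = n /\
  forall i : 'I_n,
    perm_eq (nth [::] l i) [seq val j | j <- enum 'I_n & edge G i j].

(* n, followed, for each vertex in turn, by its degree and its neighbours. *)
Definition encode (l : seq (seq nat)) : seq nat :=
  size l :: flatten [seq size a :: a | a <- l].

(* Main.v *)
Require Import Defs.
From mathcomp Require Import all_boot zify.
Set Implicit Arguments.
Unset Strict Implicit.
Unset Printing Implicit Defensive.

(* In a tree 2-spanner T, the vertices of a clique are pairwise at distance at
   most 2, so the clique lies in a closed star of T.  Applied to the two cliques
   A and B covering G, with centres a and b, this leaves three possibilities: G
   has a universal vertex, or T consists of a star on A, a star on B and one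
   further edge xy between them.  In the last case every edge of G between A
   and B meets {x, y}, and then the double star with centres x and y is also a
   tree 2-spanner.

   The partition need not be given: when a 2-admissible G has no universal
   vertex, the closed neighbourhood of any vertex v of minimum degree is one of
   the two cliques.  If e is the number of edges between A := N[v] and its
   complement, an edge ab between them is the centre of a double star that spans
   G with stretch 2 exactly when deg a + deg b >= n - 1 + e.  Four scans of the
   adjacency lists suffice: find v, mark N[v], count e, and test each edge. *)

(** * Tree 2-spanners of graphs covered by two cliques *)

Section Spanners.
Variable V : finType.
Implicit Types (G T : sgraph V) (A K : {set V}) (x y z a b v : V).

Definition nbrs G x : {set V} := [set y | edge G x y].

(** Orienting the edges out of [A] counts each of them once and matches them with arcs of the
    adjacency lists. *)
Definition crossing G A : {set V * V} :=
  [set u | [&& edge G u.1 u.2, u.1 \in A & u.2 \notin A]].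

Lemma edge_neq G x y : edge G x y -> x != y.
Proof. by apply: contraTneq => ->; rewrite edge_irrefl. Qed.

Lemma walk_dist T x y k : walk T x y k -> dist T x y <= k.
Proof.
move=> xy; rewrite /dist leqNgt; apply/negP => lt_k.
have := before_find 0 lt_k.
have := leq_trans lt_k (find_size _ _); rewrite size_iota => k_lt.
by rewrite nth_iota // add0n xy.
Qed.

(* For distinct [x] and [y]: at distance at most 2. *)
Definition near T x y : Prop :=
  edge T x y \/ exists2 z, edge T x z & edge T z y.

Lemma near_sym T x y : near T x y -> near T y x.
Proof.
by case=> [xy | [z xz zy]]; [left | right; exists z]; rewrite edge_sym.
Qed.

Lemma near_dist T x y : near T x y -> dist T x y <= 2.
Proof.
case=> [xy | [z xz zy]].
  apply: (@leq_trans 1) => //; apply: walk_dist; apply/existsP.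
  by exists [tuple of [:: y]]; rewrite /= xy eqxx.
apply: walk_dist; apply/existsP; exists [tuple of [:: z; y]].
by rewrite /= xz zy eqxx.
Qed.

(** A simple path has fewer than [#|V|] edges, so the search in [dist] succeeds and its default
    value does not occur. *)
Lemma connected_walk T x y : connected T -> walk T x y (dist T x y).
Proof.
move=> /(_ x y)/connectP[p0 path_p0 ->].
case/shortenP: path_p0 => p path_p uniq_p _ {p0}.
set P := walk _ _ _.
have has_P : has P (iota 0 #|V|).
  apply/hasP; exists (size p).
    by rewrite mem_iota add0n; have := max_card (mem (x :: p)); rewrite (card_uniqP uniq_p).
  by apply/existsP; exists (in_tuple p); rewrite /= path_p eqxx.
have := nth_find 0 has_P; rewrite nth_iota ?add0n //.
by rewrite -[X in _ < X](size_iota 0) -has_find.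
Qed.

Lemma dist_near T x y :
  connected T -> x != y -> dist T x y <= 2 -> near T x y.
Proof.
move=> /(connected_walk x y) + neq; move: (dist T x y) => k /existsP[[p /= size_p]].
move: size_p => /eqP <- /andP[].
case: p => [|z [|u [|//]]] /=; first by rewrite (negPf neq).
  by rewrite /= andbT => xz /eqP <- _; left.
by rewrite /= andbT => /andP[xz zu] /eqP <- _; right; exists z.
Qed.

(** * Trees given by a parent function *)

Section ParentTree.
Variables (par : V -> V) (depth : V -> nat) (r : V).
Hypotheses (par_root : par r = r)
  (depth_par : forall x, x != r -> depth (par x) < depth x).

(** The root is its own parent; the conjunct [x != y] removes that loop. *)
Definition parent_rel : rel V :=
  [rel x y | (x != y) && ((par x == y) || (par y == x))].

Lemma parent_rel_sym : symmetric parent_rel.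
Proof. by move=> x y; rewrite /parent_rel /= eq_sym orbC. Qed.

Lemma parent_rel_irrefl : irreflexive parent_rel.
Proof. by move=> x; rewrite /parent_rel /= eqxx. Qed.

Definition parent_tree := SGraph parent_rel_sym parent_rel_irrefl.

Lemma parent_tree_edge x : x != r -> edge parent_tree x (par x).
Proof.
move=> xr; rewrite /= /parent_rel /= eqxx andbT.
by apply: contraTneq (depth_par xr) => <-; rewrite ltnn.
Qed.

(** Following parents decreases the depth until [r] is reached. On a cycle, both neighbours of a
    deepest vertex would have to be its parent, although they are distinct. *)
Lemma parent_treeP : is_tree parent_tree.
Proof.
split.
  have sym := sym_connect_sym (edge_sym parent_tree).
  suff to_r x : connect (edge parent_tree) x r.
    by move=> x y; apply: connect_trans (to_r x) _; rewrite sym.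
  have [k] := ubnP (depth x); elim: k x => // k IH x le_x.
  have [->|xr] := eqVneq x r; first exact: connect0.
  apply: connect_trans (connect1 (parent_tree_edge xr)) (IH _ _).
  exact: leq_trans (depth_par xr) le_x.
move=> c /andP[cyc_c uniq_c]; rewrite ltnNge; apply/negP => size_c.
have [z0 z0c] : exists z, z \in c.
  by case: c size_c {cyc_c uniq_c} => // z c; exists z; rewrite mem_head.
have [z zc z_max] : exists2 z, z \in c & forall y, y \in c -> depth y <= depth z.
  case: (@arg_maxnP V z0 (mem c) depth z0c) => z zc z_max.
  by exists z => // y /z_max.
have toward y : y \in c -> edge parent_tree z y -> y = par z.
  move=> yc; case/andP=> zy /orP[/eqP //|/eqP par_y].
  have [yr|yr] := eqVneq y r; first by rewrite -par_y yr par_root eqxx in zy.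
  by have := depth_par yr; rewrite par_y ltnNge z_max.
have [i c' rot_c] := rot_to zc.
have {}size_c : 2 < size (z :: c') by rewrite -rot_c size_rot.
have {}uniq_c : uniq (z :: c') by rewrite -rot_c rot_uniq.
have {}cyc_c : cycle (edge parent_tree) (z :: c') by rewrite -rot_c rot_cycle.
have mem_c' y : y \in c' -> y \in c.
  by move=> y_c'; rewrite -(mem_rot i) rot_c inE y_c' orbT.
case/lastP: c' => [//|c' w] in size_c uniq_c cyc_c mem_c' {rot_c}.
case: c' => [//|u c'] in size_c uniq_c cyc_c mem_c'.
move: cyc_c; rewrite /cycle rcons_path last_rcons => /andP[].
rewrite rcons_cons => /andP[zu _]; rewrite edge_sym => zw.
have uw : u = w.
  have -> : u = par z by apply: toward; rewrite // mem_c' ?mem_head.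
  by apply/esym/toward; rewrite // mem_c' // inE mem_rcons mem_head orbT.
by move: uniq_c; rewrite uw rcons_cons /= mem_rcons mem_head andbF.
Qed.

End ParentTree.

(** The tree is rooted at [a]: the children of [a] are [b] and the rest of [A], and all other
    vertices hang from [b]. An edge across that meets [a] or [b] is replaced by a path through the
    tree edge [ab]. The case [A = setT] covers the single star of a universal vertex. *)
Lemma double_star_admissible G A a b :
    a \in A ->
    (forall x, x \in A -> x != a -> edge G a x) ->
    (forall x, x \notin A -> x != b -> edge G b x) ->
    (b \notin A -> edge G a b) -> (b \in A -> A = setT) ->
    (forall x y, x \in A -> y \notin A -> edge G x y -> x = a \/ y = b) ->
  admissible 2 G.
Proof.
move=> aA adj_a adj_b ab bA cover.
pose par x := if (x \in A) || (x == b) then a else b.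
pose depth x := if x == a then 0 else if (x \in A) || (x == b) then 1 else 2.
have par_a : par a = a by rewrite /par aA.
have depth_par x : x != a -> depth (par x) < depth x.
  move=> xa; rewrite /depth /par (negPf xa); case: (_ || _); first by rewrite eqxx.
  by rewrite eqxx orbT; case: ifP.
pose T := parent_tree par.
have TP := parent_treeP par_a depth_par.
have Tpar := parent_tree_edge depth_par.
have TA x : x \in A -> x != a -> edge T a x.
  by move=> xA /Tpar; rewrite /par xA edge_sym.
have Tab : b \notin A -> edge T a b.
  move=> nbA; have ba : b != a by apply: contraNneq nbA => ->.
  by have := Tpar _ ba; rewrite /par eqxx orbT edge_sym.
have TB x : x \notin A -> x != b -> edge T b x.
  move=> xA xb; have xa : x != a by apply: contraNneq xA => ->.
  by have := Tpar _ xa; rewrite /par (negPf xA) (negPf xb) edge_sym.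
have nbA x : x \notin A -> b \notin A.
  by apply: contra => /bA ->; rewrite inE.
exists T; split; first split => //.
  have sub x : x != a -> edge G x (par x).
    move=> xa; rewrite /par edge_sym; case: ifPn.
      case/boolP: (x \in A) => [xA _ | xA /= /eqP xb]; first exact: adj_a.
      by rewrite xb ab // -xb.
    by rewrite negb_or => /andP[xA xb]; exact: adj_b.
  move=> x y /andP[xy /orP[/eqP par_x | /eqP par_y]].
    by rewrite -par_x sub //; apply: contraNneq xy => xa; rewrite -par_x xa par_a.
  rewrite edge_sym -par_y sub //.
  by apply: contraNneq xy => ya; rewrite -par_y ya par_a.
have across x y : x \in A -> y \notin A -> edge G x y -> near T x y.
  move=> xA yA xy; have Tab' := Tab (nbA _ yA).
  have [xa|xa] := eqVneq x a.
    rewrite xa; have [->|yb] := eqVneq y b; first by left.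
    by right; exists b => //; apply: TB.
  case: (cover _ _ xA yA xy) => [xa'|->]; first by rewrite xa' eqxx in xa.
  by right; exists a => //; rewrite edge_sym TA.
have through z x y : edge G x y -> (x != z -> edge T z x) ->
    (y != z -> edge T z y) -> near T x y.
  move=> xy zx zy; have [xz|xz] := eqVneq x z.
    by left; rewrite xz zy // -xz eq_sym (edge_neq xy).
  have [yz|yz] := eqVneq y z; first by left; rewrite yz edge_sym zx.
  by right; exists z; [rewrite edge_sym zx | exact: zy].
move=> x y xy; apply: near_dist.
case: (boolP (x \in A)) (boolP (y \in A)) => xA [] yA.
- by apply: (through a) => // ?; apply: TA.
- exact: across.
- by apply: near_sym; apply: across; rewrite // edge_sym.
- by apply: (through b) => // ?; apply: TB.
Qed.

(** * Cliques and stars in a tree 2-spanner *)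

(** A simple path from [x] to [y] that avoids the edge [xy] has at least two edges, so adding [xy]
    closes it to a cycle. *)
Lemma acyclic_bridge T x y : acyclic T -> edge T x y ->
  ~~ connect [rel u v | edge T u v && ~~ [|| (u == x) && (v == y)
                                         | (u == y) && (v == x)]] x y.
Proof.
move=> acyc xy; apply/negP => /connectP[p0 path_p0].
case/shortenP: path_p0 => p path_p uniq_p _ last_p {p0}.
have path_T : path (edge T) x p by apply: sub_path path_p => u v /andP[].
have cyc : ucycle (edge T) (x :: p).
  by rewrite /ucycle uniq_p andbT /= rcons_path path_T -last_p edge_sym.
have := acyc _ cyc; case: p path_p last_p {uniq_p path_T cyc} => [_ /= yx | z [|//]].
  by rewrite yx edge_irrefl in xy.
by move=> /= /andP[/andP[_]] + _ zy; rewrite -zy !eqxx.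
Qed.

(** If [K] contains an edge [xy] of [T], short closed walks force [x] or [y] to be a centre.
    Otherwise the vertices of [K] are joined pairwise through vertices outside [K], and two
    different middle vertices would yield a 6-cycle. The vertex [x0] serves as centre when [K] is
    empty. *)
Lemma clique_star T K (x0 : V) : acyclic T ->
    {in K &, forall x y, x != y -> near T x y} ->
  exists c, forall x, x \in K -> x != c -> edge T c x.
Proof.
move=> acyc near_K.
have cyc c : cycle (edge T) c -> 2 < size c -> ~~ uniq c.
  move=> cyc_c size_c; apply/negP => uniq_c.
  have := acyc c; rewrite /ucycle cyc_c uniq_c => /(_ isT).
  by rewrite ltnNge size_c.
have no3 x y z : edge T x y -> edge T y z -> edge T z x -> False.
  move=> xy yz zx; have := cyc [:: x; y; z].
  rewrite /= xy yz zx !inE !negb_or (edge_neq xy) (edge_neq yz).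
  by rewrite [x == z]eq_sym (edge_neq zx) => /(_ isT isT).
have no4 x y z t : edge T x y -> edge T y z -> edge T z t -> edge T t x ->
    x = z \/ y = t.
  move=> xy yz zt tx; case: (eqVneq x z); first by left.
  case: (eqVneq y t); first by right.
  move=> yt xz; have := cyc [:: x; y; z; t].
  rewrite /= xy yz zt tx !inE !negb_or (edge_neq xy) (edge_neq yz).
  by rewrite (edge_neq zt) [x == t]eq_sym (edge_neq tx) xz yt => /(_ isT isT).
(* If two vertices of a closed walk of length 5 coincide, a triangle remains; otherwise the walk is
   a 5-cycle. *)
have no5 x y z t u : edge T x y -> edge T y z -> edge T z t -> edge T t u ->
    edge T u x -> False.
  move=> xy yz zt tu ux.
  have [xz|xz] := eqVneq x z; first by apply: (no3 z t u) => //; rewrite -xz.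
  have [xt|xt] := eqVneq x t; first by apply: (no3 x y z) => //; rewrite xt.
  have [yt|yt] := eqVneq y t; first by apply: (no3 x y u); rewrite // yt.
  have [yu|yu] := eqVneq y u; first by apply: (no3 y z t); rewrite // yu.
  have [zu|zu] := eqVneq z u; first by apply: (no3 x y z); rewrite // zu.
  have := cyc [:: x; y; z; t; u].
  rewrite /= xy yz zt tu ux !inE !negb_or (edge_neq xy) (edge_neq yz).
  rewrite (edge_neq zt) (edge_neq tu) [x == u]eq_sym (edge_neq ux).
  by rewrite xz xt yt yu zu => /(_ isT isT).
have [[x xK [y yK xy]] | no_edge] :
    (exists2 x, x \in K & exists2 y, y \in K & edge T x y) \/
    {in K &, forall x y, ~~ edge T x y}.
  case: (boolP [exists x in K, exists y in K, edge T x y]).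
    by move=> /exists_inP[x xK /exists_inP[y yK xy]]; left; exists x => //; exists y.
  move=> no; right => x y xK yK; apply: contra no => xy.
  by apply/exists_inP; exists x => //; apply/exists_inP; exists y.
- have adj w : w \in K -> w != x -> w != y -> edge T x w \/ edge T y w.
    move=> wK wx wy.
    move: wx wy; rewrite !(eq_sym w) => wx wy.
    have [xw | [p xp pw]] := near_K x w xK wK wx; first by left.
    have [yw | [q yq qw]] := near_K y w yK wK wy; first by right.
    case: (no5 x p w q y) => //; by rewrite edge_sym.
  case: (boolP [forall w in K, (w != x) ==> edge T x w]) => [/forall_inP star_x|].
    by exists x => w wK wx; apply: (implyP (star_x _ wK)).
  case/forall_inPn => w wK; rewrite negb_imply => /andP[wx xw].
  have [wy|wy] := eqVneq w y; first by rewrite wy xy in xw.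
  have yw : edge T y w by case: (adj w wK wx wy) => // xw'; rewrite xw' in xw.
  (* Here [w] hangs from [y] only. A [w'] hanging from [x] would close, with a shortest connection
     from [w] to [w'], a walk of length 4 or 5 through [xy]. *)
  exists y => w' w'K w'y; have [->|w'x] := eqVneq w' x; first by rewrite edge_sym.
  case: (adj w' w'K w'x w'y) => // xw'.
  have ww' : w != w' by apply: contraNneq xw => ->.
  case: (near_K w w' wK w'K ww') => [ew | [r wr rw']].
    have [] := no4 w w' x y ew; rewrite ?[edge T w' x]edge_sym // => E.
      by rewrite E eqxx in wx.
    by rewrite E eqxx in w'y.
  by case: (no5 x w' r w y); rewrite // edge_sym.
- have [/existsP[x /andP[xK /existsP[y /andP[yK xy]]]] | trivial_K] :=
      boolP [exists x, (x \in K) && [exists y, (y \in K) && (x != y)]]; last first.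
    case: (set_0Vmem K) => [-> | [x xK]]; first by exists x0 => x; rewrite inE.
    exists x => y yK yx; case/negP: trivial_K; apply/existsP; exists x.
    by rewrite xK; apply/existsP; exists y; rewrite yK eq_sym.
  have two u v : u \in K -> v \in K -> u != v ->
      exists2 z, edge T u z & edge T z v.
    by move=> uK vK /(near_K _ _ uK vK)[] // uv; case/negP: (no_edge u v uK vK).
  have apart u v : v \in K -> edge T u v -> u \notin K.
    by move=> vK uv; apply/negP => uK; case/negP: (no_edge u v uK vK).
  have [z xz zy] := two x y xK yK xy.
  exists z => w wK wz; apply: contraT => zw.
  have wx : w != x by apply: contraNneq zw => ->; rewrite edge_sym.
  have wy : w != y by apply: contraNneq zw => ->.
  have [p wp px] := two w x wK xK wx; have [q wq qy] := two w y wK yK wy.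
  have pK : p \notin K by apply: apart px.
  have qK : q \notin K by apply: apart qy.
  have outside u v : u \in K -> v \notin K -> u != v.
    by move=> uK; apply: contraNneq => <-.
  have pz : p != z by apply: contraNneq zw => <-; rewrite edge_sym.
  have qz : q != z by apply: contraNneq zw => <-; rewrite edge_sym.
  (* If [p] and [q] coincided, [x z y p] would be a 4-cycle. The other inequalities needed for the
     6-cycle [w p x z y q] mostly hold because [w], [x], [y] lie in [K] and [p], [z], [q] do not. *)
  have pq : p != q.
    apply/eqP => pq; have yp : edge T y p by rewrite pq edge_sym.
    case: (no4 x z y p xz zy yp px) => E; first by rewrite E eqxx in xy.
    by rewrite E eqxx in pz.
  have := cyc [:: w; p; x; z; y; q].
  rewrite /= wp px xz zy [edge T y q]edge_sym qy [edge T q w]edge_sym wq.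
  rewrite !inE !negb_or pz pq xy wx wy.
  rewrite [p == x]eq_sym [p == y]eq_sym [z == y]eq_sym [z == q]eq_sym qz.
  have zK : z \notin K by apply: apart zy.
  by rewrite !outside // => /(_ isT isT).
Qed.

(** As stars of [T] span both sides, exactly one edge [xy] of [T] runs between them. An edge [uv] of
    [G] across is either this edge or replaced by two edges of [T], one of which crosses and hence
    is [xy]. *)
Lemma star_cover G T A a b :
    acyclic T -> connected T -> subrel (edge T) (edge G) ->
    (forall x y, edge G x y -> near T x y) ->
    a \in A -> b \notin A ->
    (forall x, x \in A -> x != a -> edge T a x) ->
    (forall x, x \notin A -> x != b -> edge T b x) ->
  exists x y, [/\ x \in A, y \notin A, edge G x y &
    forall u v, u \in A -> v \notin A -> edge G u v -> u = x \/ v = y].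
Proof.
move=> acyc conn sub nearG aA bA star_a star_b.
have [x [y [xA yA xy]]] : exists x y, [/\ x \in A, y \notin A & edge T x y].
  have /connectP[p path_p last_p] := conn a b.
  elim: p a aA path_p last_p {star_a} => [a aA _ ba | y p IH a aA].
    by rewrite ba aA in bA.
  rewrite /= => /andP[ay path_p] last_p; case: (boolP (y \in A)) => yA.
    exact: IH yA path_p last_p.
  by exists a, y.
(* A second crossing edge [uv] would give the detour from [x] via [a], [u], [v], [b] to [y],
   although [xy] is a bridge. *)
have only u v : u \in A -> v \notin A -> edge T u v -> u = x /\ v = y.
  move=> uA vA uv; case: (boolP ((u == x) && (v == y))) => [/andP[/eqP-> /eqP->] //|].
  move=> ne; case/negP: (acyclic_bridge acyc xy); set E := (X in connect X).
  have E_same w w' : edge T w w' -> (w \in A) = (w' \in A) -> connect E w w'.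
    move=> ww' same; apply/connect1/andP; split=> //; apply/negP.
    by case/orP=> /andP[/eqP Ew /eqP Ew']; move: same; rewrite Ew Ew' xA (negPf yA).
  have to_a w : w \in A -> connect E a w /\ connect E w a.
    move=> wA; have [->|wa] := eqVneq w a; first by split; apply: connect0.
    have aw := star_a _ wA wa.
    by split; apply: E_same; rewrite ?wA ?aA // edge_sym.
  have to_b w : w \notin A -> connect E b w /\ connect E w b.
    move=> wA; have [->|wb] := eqVneq w b; first by split; apply: connect0.
    have bw := star_b _ wA wb.
    by split; apply: E_same; rewrite ?(negPf wA) ?(negPf bA) // edge_sym.
  have E_uv : E u v.
    rewrite /E /= uv negb_or ne /=; apply/negP => /andP[/eqP uy _].
    by move: uA; rewrite uy (negPf yA).
  apply: connect_trans (to_a x xA).2 (connect_trans (to_a u uA).1 _).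
  apply: connect_trans (connect1 E_uv) _.
  exact: connect_trans (to_b v vA).2 (to_b y yA).1.
exists x, y; split=> //; first exact: sub.
move=> u v uA vA /nearG[/only[]// -> _ | [z uz zv]]; first by left.
case: (boolP (z \in A)) => zA; first by case: (only z v zA vA zv); right.
by case: (only u z uA zA uz); left.
Qed.

Lemma card_nbrs_split G A x :
  #|nbrs G x| = #|nbrs G x :&: A| + #|nbrs G x :\: A|.
Proof. by rewrite cardsID. Qed.

(** The centre of the star on a clique must lie in that clique: a centre outside would be adjacent
    to this clique by the star and to the rest by the other clique, hence universal. *)
Lemma admissible2_cover G A (x0 : V) :
    admissible 2 G -> clique G A -> clique G (~: A) ->
    (forall x, ~ forall y, y != x -> edge G x y) ->
  exists x y, [/\ x \in A, y \notin A, edge G x y &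
    forall u v, u \in A -> v \notin A -> edge G u v -> u = x \/ v = y].
Proof.
case=> T [[[conn acyc] sub] dist2] clA clB no_univ.
have nearG x y : edge G x y -> near T x y.
  by move=> xy; apply: dist_near (edge_neq xy) (dist2 _ _ xy).
have star K : clique G K -> exists c, forall x, x \in K -> x != c -> edge T c x.
  move=> clK; apply: clique_star x0 acyc _ => x y xK yK xy.
  by apply: nearG; apply: clK.
have [a star_a] := star A clA; have [b star_b] := star _ clB.
have inC x : (x \in ~: A) = (x \notin A) by rewrite inE.
apply: (star_cover acyc conn sub nearG (a := a) (b := b)).
- apply: contraT => aA; case: (no_univ a) => y ya.
  case: (boolP (y \in A)) => yA; first exact/sub/star_a.
  by apply: clB; rewrite ?inC // eq_sym.
- apply/negP => bA; case: (no_univ b) => y yb.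
  case: (boolP (y \in A)) => yA; first by apply: clA; rewrite // eq_sym.
  by apply/sub/star_b; rewrite ?inC.
- exact: star_a.
- by move=> x xA; apply: star_b; rewrite inC.
Qed.

(** * The degree criterion *)

(** Since [y] is not universal, some [z] in [A] has no neighbour outside [A], so its degree is
    [#|A| - 1] and [v] can have no neighbour outside either; thus [N[v]] is [A]. For the count, the
    crossing edges at [x] and those at [y] cover all crossing edges and share [xy]. *)
Lemma criterion_necessary G A x y v :
    clique G A -> clique G (~: A) -> x \in A -> y \notin A -> edge G x y ->
    (forall u w, u \in A -> w \notin A -> edge G u w -> u = x \/ w = y) ->
    ~ (forall z, z != y -> edge G y z) ->
    v \in A -> (forall u, #|nbrs G v| <= #|nbrs G u|) ->
  v |: nbrs G v = A /\ #|V| + #|crossing G A| < #|nbrs G x| + #|nbrs G y| + 2.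
Proof.
move=> clA clB xA yA xy cover no_univ vA v_min.
have inA u : u \in A -> nbrs G u :&: A = A :\ u.
  move=> uA; apply/setP => w; rewrite !inE andbC.
  case: (boolP (w \in A)) => wA; rewrite ?andbF //= andbT.
  by case: eqVneq => [->|wu]; rewrite ?edge_irrefl // clA // eq_sym.
have inB u : u \notin A -> nbrs G u :\: A = (~: A) :\ u.
  move=> uA; apply/setP => w; rewrite !inE.
  case: (boolP (w \in A)) => wA; rewrite ?andbF //= andbT.
  by case: eqVneq => [->|wu]; rewrite ?edge_irrefl // clB ?inE // eq_sym.
have out u w : u \in A -> u != x -> w \in nbrs G u :\: A -> w = y.
  rewrite !inE => uA ux /andP[wA uw].
  by case: (cover u w uA wA uw) => // E; rewrite E eqxx in ux.
have vy : ~~ edge G v y.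
  apply/negP => vy; apply: no_univ => z zy; rewrite edge_sym.
  case: (boolP (z \in A)) => zA; last by rewrite edge_sym clB ?inE // eq_sym.
  have [->//|zx] := eqVneq z x; apply: contraT => nzy.
  have := v_min z; rewrite !(card_nbrs_split G A) !inA // leqNgt => /negP[].
  rewrite [#|nbrs G z :\: A|](_ : _ = 0); last first.
    apply: eq_card0 => w; apply/negP => wz; have wy := out z w zA zx wz.
    by move: wz; rewrite wy !inE (negPf nzy) andbF.
  have := cardsD1 v A; have := cardsD1 z A; rewrite vA zA.
  have : 0 < #|nbrs G v :\: A| by apply/card_gt0P; exists y; rewrite !inE yA vy.
  lia.
have vx : v != x by apply: contraNneq vy => ->.
split.
  apply/setP => w; rewrite !inE; case: (boolP (w \in A)) => wA.
    by case: eqVneq => //= wv; apply: clA; rewrite // eq_sym.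
  apply/norP; split; first by apply: contraNneq wA => ->.
  apply/negP => vw; have := out v w vA vx; rewrite !inE wA vw => /(_ isT) wy.
  by rewrite -wy vw in vy.
pose X := [set (x, w) | w in nbrs G x :\: A].
pose Y := [set (w, y) | w in nbrs G y :&: A].
have cross_XY : crossing G A \subset X :|: Y.
  apply/subsetP => -[u w]; rewrite !inE /= => /and3P[uw uA wA].
  case: (cover u w uA wA uw) => E; subst; apply/orP; [left|right].
    by apply: imset_f; rewrite !inE wA.
  by apply: (imset_f (fun w => (w, y))); rewrite !inE uA edge_sym uw.
have cX : #|X| = #|nbrs G x :\: A| by rewrite card_imset // => ? ? [].
have cY : #|Y| = #|nbrs G y :&: A| by rewrite card_imset // => ? ? [].
have XY : 0 < #|X :&: Y|.
  apply/card_gt0P; exists (x, y); rewrite inE.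
  rewrite imset_f ?(imset_f (fun w => (w, y))) // !inE ?xA ?yA ?andbT //=.
  by rewrite edge_sym.
have : #|crossing G A| + #|X :&: Y| <= #|X| + #|Y|.
  by rewrite -cardsUI leq_add2r subset_leq_card.
rewrite !(card_nbrs_split G A) (inA x) // (inB y) //.
have := cardsD1 x A; have := cardsD1 y (~: A); rewrite xA inE yA /=.
have := cardsC A; rewrite cX cY => <- -> ->; move: XY.
move: #|X :&: Y| #|crossing G A| #|A :\ x| #|~: A :\ y| #|nbrs G x :\: A| #|nbrs G y :&: A|. lia.
Qed.

(** The degree sum plus 2 is always at most [#|V| + #|crossing G A| + 1]. Equality makes every
    estimate sharp: [a] sees all of [A], [b] sees all of its complement, and each crossing edge
    meets [a] or [b], so the double star works. *)
Lemma criterion_sufficient G A a b : clique G (~: A) ->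
    a \in A -> b \notin A -> edge G a b ->
    #|V| + #|crossing G A| < #|nbrs G a| + #|nbrs G b| + 2 ->
  admissible 2 G.
Proof.
move=> clB aA bA ab big.
pose X := [set (a, w) | w in nbrs G a :\: A].
pose Y := [set (w, b) | w in nbrs G b :&: A].
have XY_cross : X :|: Y \subset crossing G A.
  apply/subsetP => u; rewrite !inE => /orP[] /imsetP[w]; rewrite !inE.
    by move=> /andP[wA aw] ->; rewrite /= aw aA.
  by move=> /andP[bw wA] ->; rewrite /= edge_sym bw wA.
have cX : #|X| = #|nbrs G a :\: A| by rewrite card_imset // => ? ? [].
have cY : #|Y| = #|nbrs G b :&: A| by rewrite card_imset // => ? ? [].
have XY : X :&: Y \subset [set (a, b)].
  apply/subsetP => u; rewrite !inE => /andP[/imsetP[w _ ->] /imsetP[w' _ [_ ->]]].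
  by [].
have subA : nbrs G a :&: A \subset A :\ a.
  apply/subsetP => w; rewrite !inE => /andP[aw ->].
  by rewrite eq_sym (edge_neq aw).
have subB : nbrs G b :\: A \subset (~: A) :\ b.
  apply/subsetP => w; rewrite !inE => /andP[-> bw].
  by rewrite eq_sym (edge_neq bw).
move: big; rewrite !(card_nbrs_split G A) -cX -cY => big.
have cUI : #|X :|: Y| + #|X :&: Y| = #|X| + #|Y| by rewrite cardsUI.
have [le_a le_b le_XY] : [/\ #|A :\ a| <= #|nbrs G a :&: A|,
    #|(~: A) :\ b| <= #|nbrs G b :\: A| & #|crossing G A| <= #|X :|: Y|].
  move: (subset_leq_card subA) (subset_leq_card subB) (subset_leq_card XY_cross).
  move: (subset_leq_card XY) big; rewrite cards1 -(cardsC A).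
  rewrite (cardsD1 a A) (cardsD1 b (~: A)) aA inE bA /= {XY_cross}; move: cUI.
  move: #|A :\ a| #|(~: A) :\ b| #|nbrs G a :&: A| #|nbrs G b :\: A|.
   move: #|crossing G A| #|X :|: Y| #|X :&: Y| #|X| #|Y| => *; split; lia.
have eqA : nbrs G a :&: A = A :\ a by apply/eqP; rewrite eqEcard subA.
have eqB : nbrs G b :\: A = (~: A) :\ b by apply/eqP; rewrite eqEcard subB.
have eqX : X :|: Y = crossing G A by apply/eqP; rewrite eqEcard XY_cross.
apply: (@double_star_admissible G A a b) => //.
- move=> x xA xa; have : x \in A :\ a by rewrite !inE xa.
  by rewrite -eqA !inE => /andP[].
- move=> x xA xb; have : x \in (~: A) :\ b by rewrite !inE xb.
  by rewrite -eqB !inE => /andP[].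
- by rewrite (negPf bA).
- move=> x y xA yA xy; have : (x, y) \in X :|: Y by rewrite eqX inE /= xy xA.
  by rewrite inE => /orP[]/imsetP[w _ [-> ->]]; [left|right].
Qed.

Lemma universal_admissible G a : (forall x, x != a -> edge G a x) -> admissible 2 G.
Proof.
move=> a_univ.
apply: (@double_star_admissible G setT a a) => [|x _ /a_univ|x|||x y] //.
all: by rewrite ?inE.
Qed.

Lemma universalP G a : reflect (forall x, x != a -> edge G a x) (#|V| < #|nbrs G a| + 2).
Proof.
have sub : nbrs G a \subset [set~ a].
  by apply/subsetP => x; rewrite !inE eq_sym; apply: edge_neq.
have cV : #|V| = #|[set~ a]|.+1 by rewrite cardsC1 prednK //; apply/card_gt0P; exists a.
apply: (iffP idP) => [big x xa | a_univ].
  have eqN : nbrs G a = [set~ a] by apply/eqP; rewrite eqEcard sub; lia.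
  have : x \in [set~ a] by rewrite !inE.
  by rewrite -eqN inE.
have : [set~ a] \subset nbrs G a by apply/subsetP => x; rewrite !inE; apply: a_univ.
by move/subset_leq_card; lia.
Qed.

(** The clique containing [v] lies in [N[v]], so the complement of [N[v]] lies in the other clique;
    this gives sufficiency without knowing the partition. For necessity, [v] may lie in either
    clique, and the situation is symmetric under exchanging them. *)
Theorem admissible2P G v : zero_two_graph G ->
    (forall u, #|nbrs G v| <= #|nbrs G u|) ->
  let A := v |: nbrs G v in
  admissible 2 G <->
  (exists a, #|V| < #|nbrs G a| + 2) \/
  (exists a b, [/\ a \in A, b \notin A, edge G a b &
     #|V| + #|crossing G A| < #|nbrs G a| + #|nbrs G b| + 2]).
Proof.
case=> A0 [clA clB] v_min A; split; last first.
  case=> [[a /universalP/universal_admissible //] | [a [b [aA bA ab big]]]].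
  apply: criterion_sufficient aA bA ab big => x y; rewrite !inE !negb_or.
  move=> /andP[xv vx] /andP[yv vy] xy.
  have [vA|vA] := boolP (v \in A0).
    apply: clB => //; rewrite inE.
      by apply: contra vx => xA; apply: clA; rewrite // eq_sym.
    by apply: contra vy => yA; apply: clA; rewrite // eq_sym.
  apply: clA => //.
    by apply: contraR vx => xA; apply: clB; rewrite ?inE // eq_sym.
  by apply: contraR vy => yA; apply: clB; rewrite ?inE // eq_sym.
move=> adm; case: (boolP [exists a, #|V| < #|nbrs G a| + 2]) => [/existsP|]; first by left.
rewrite negb_exists => /forallP no_univ; right.
have {}no_univ x : ~ forall y, y != x -> edge G x y.
  by move/universalP; apply/negP.
have [x [y [xA yA xy cover]]] := admissible2_cover v adm clA clB no_univ.
case: (boolP (v \in A0)) => vA.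
  have [EA big] := criterion_necessary clA clB xA yA xy cover (no_univ y) vA v_min.
  by exists x, y; rewrite /A EA.
have vB : v \in ~: A0 by rewrite inE.
have yB : y \in ~: A0 by rewrite inE.
have xB : x \notin ~: A0 by rewrite inE xA.
have clAC : clique G (~: ~: A0) by rewrite setCK.
have yx : edge G y x by rewrite edge_sym.
have coverC u w : u \in ~: A0 -> w \notin ~: A0 -> edge G u w -> u = y \/ w = x.
  rewrite !inE negbK edge_sym => uA wA uw.
  by case: (cover w u wA uA uw); [right | left].
have [EA big] := criterion_necessary clB clAC yB xB yx coverC (no_univ x) vB v_min.
by exists y, x; rewrite /A EA.
Qed.
End Spanners.

(** * Running time of programs *)

(** Total correctness with a bound on the number of steps. *)
Definition runs w p s t (Q : state -> Prop) :=
  exists s' t', [/\ exec w p s s' t', t' <= t & Q s'].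

Lemma runs_weaken w p s t u (P Q : state -> Prop) :
  runs w p s t P -> t <= u -> (forall s', P s' -> Q s') -> runs w p s u Q.
Proof.
move=> [s' [t' [ex le_t Ps']]] tu PQ; exists s', t'; split=> //.
  exact: leq_trans le_t tu.
exact: PQ.
Qed.

Lemma runs_seq w p q s t u (P Q : state -> Prop) :
  runs w p s t P -> (forall s', P s' -> runs w q s' u Q) ->
  runs w (Seq p q) s (t + u) Q.
Proof.
move=> [s1 [t1 [ex1 le1 Ps1]]] /(_ _ Ps1)[s2 [t2 [ex2 le2 Qs2]]].
by exists s2, (t1 + t2); split=> //; [apply: ExecSeq ex1 ex2 | rewrite leq_add].
Qed.

(** Weakest preconditions for loop-free code; loops are rejected here and treated through [runs]. *)
Fixpoint wp w p (Q : state -> Prop) s : Prop :=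
  match p with
  | Skip => Q s
  | Instr i => result i s < w /\ Q (step i s)
  | Seq p q => wp w p (wp w q Q) s
  | IfLt a b p q => if reg s a < reg s b then wp w p Q s else wp w q Q s
  | WhileLt _ _ _ => False
  end.

(** Adding both branches of a test gives a bound independent of the state. The value at [WhileLt] is
    a dummy, since [wp] is false there. *)
Fixpoint cost p : nat :=
  match p with
  | Skip | Instr _ | WhileLt _ _ _ => 1
  | Seq p q => cost p + cost q
  | IfLt _ _ p q => (cost p + cost q).+1
  end.

Lemma wp_runs w p (Q : state -> Prop) s : wp w p Q s -> runs w p s (cost p) Q.
Proof.
elim: p Q s => [|i|p IHp q IHq|a b p IHp q IHq|//] Q s /=.
- by move=> Qs; exists s, 1; split=> //; apply: ExecSkip.
- by case=> lt_w Qs; exists (step i s), 1; split=> //; apply: ExecInstr.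
- by move=> /IHp runs_p; apply: (runs_seq runs_p) => s' /IHq.
- case: ifP => [ab /IHp|ab /IHq] [s' [t [ex le_t Qs']]].
    exists s', t.+1; split=> //; first by apply: ExecIf; rewrite ab.
    by rewrite ltnS (leq_trans le_t) ?leq_addr.
  exists s', t.+1; split=> //; first by apply: ExecIf; rewrite ab.
  by rewrite ltnS (leq_trans le_t) ?leq_addl.
Qed.

Lemma runs_while_stop w a b p s (Q : state -> Prop) :
  reg s b <= reg s a -> Q s -> runs w (WhileLt a b p) s 1 Q.
Proof. by move=> ba Qs; exists s, 1; split=> //; apply: ExecWhileStop. Qed.

Lemma runs_while_loop w a b p s t u (P Q : state -> Prop) :
  reg s a < reg s b -> runs w p s t P ->
  (forall s', P s' -> runs w (WhileLt a b p) s' u Q) ->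
  runs w (WhileLt a b p) s (t + u).+1 Q.
Proof.
move=> ab [s1 [t1 [ex1 le1 Ps1]]] /(_ _ Ps1)[s2 [t2 [ex2 le2 Qs2]]].
exists s2, (t1 + t2).+1; split=> //; last by rewrite ltnS leq_add.
exact: ExecWhileLoop ex1 ex2.
Qed.

(** * Scanning the encoded adjacency lists *)

Section Rows.
Variables (l : seq (seq nat)) (w : nat).

Definition row i := nth [::] l i.
Definition deg i := size (row i).
Definition arcs k : seq (nat * nat) :=
  flatten [seq [seq (i, u) | u <- row i] | i <- iota 0 k].
(* Address of the first cell of row [k] in [encode l]. *)
Definition offset k := (size (arcs k) + k).+1.
Local Notation n := (size l).
Local Notation L := (size (encode l)).

Lemma arcsS k : arcs k.+1 = arcs k ++ [seq (k, u) | u <- row k].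
Proof. by rewrite /arcs -addn1 iotaD map_cat flatten_cat /= cats0. Qed.

Lemma mem_arcs k i u : ((i, u) \in arcs k) = (i < k) && (u \in row i).
Proof.
elim: k => [//|k IH]; rewrite arcsS mem_cat IH ltnS [in RHS]leq_eqVlt.
case: (eqVneq i k) => [-> | ik] /=; last first.
  case: (i < k) => //=; first case: (u \in row i) => //=.
    by apply/mapP => -[v _ [E _]]; rewrite E eqxx in ik.
  by apply/mapP => -[v _ [E _]]; rewrite E eqxx in ik.
by rewrite ltnn mem_map // => ? ? [].
Qed.

Lemma offsetS k : offset k.+1 = (offset k + deg k).+1.
Proof. rewrite /offset arcsS size_cat size_map /deg; lia. Qed.

Lemma encode_offset k : k <= n ->
  drop (offset k) (encode l) = flatten [seq size a :: a | a <- drop k l].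
Proof.
elim: k => [_|k IH lt_k]; first by rewrite /offset /= !drop0.
rewrite offsetS -addnS addnC -drop_drop IH 1?ltnW //.
by rewrite (drop_nth [::] lt_k) /= drop_size_cat.
Qed.

Lemma size_encode : L = (sumn [seq size a | a <- l] + n).+1.
Proof.
rewrite /= size_flatten /shape -map_comp; congr _.+1.
by elim: (l) => //= a l' ->; lia.
Qed.

Lemma offset_size : offset n = L.
Proof.
rewrite size_encode /offset /arcs size_flatten /shape -map_comp.
congr ((sumn _ + _).+1); rewrite -[in RHS](mkseq_nth [::] l) /mkseq -map_comp.
by apply: eq_map => i; rewrite /= size_map.
Qed.

Lemma offset_mono : {homo offset : i k / i <= k}.
Proof.
apply: homo_leq => // [i k m|i]; first exact: leq_trans.
by rewrite offsetS -addnS leq_addr.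
Qed.

Lemma offset_lt k : k < n -> offset k + deg k < L.
Proof. by move=> lt_k; rewrite -offset_size -offsetS; apply: offset_mono. Qed.

Lemma encode_deg k : k < n -> nth 0 (encode l) (offset k) = deg k.
Proof.
move=> lt_k; rewrite -[offset k]addn0 -nth_drop encode_offset 1?ltnW //.
by rewrite (drop_nth [::] lt_k).
Qed.

Lemma encode_row k j : k < n -> j < deg k ->
  nth 0 (encode l) (offset k + j).+1 = nth 0 (row k) j.
Proof.
move=> lt_k lt_j; rewrite -addnS -nth_drop encode_offset 1?ltnW //.
by rewrite (drop_nth [::] lt_k) /= nth_cat -/(row k) -/(deg k) lt_j.
Qed.

(* Runs [head] on each row [i] of the input (register 3), of degree [d]
   (register 6), then [body] on each neighbour [u] (register 7) in that row.
   Register 4 is the reading position and register 5 the end of the row. *)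
Definition for_rows (head body : program) : program :=
  Seq (Instr (Const 3 0)) (Seq (Instr (Const 4 1))
  (WhileLt 3 1
    (Seq (Instr (Read 6 4)) (Seq (Instr (Add 4 4 2)) (Seq head
    (Seq (Instr (Add 5 4 6))
    (Seq (WhileLt 4 5
            (Seq (Instr (Read 7 4)) (Seq body (Instr (Add 4 4 2)))))
         (Instr (Add 3 3 2))))))))).

(** Only the input cells are protected; addresses from [L] on are free as working storage. *)
Definition ctrl s : Prop :=
  [/\ reg s 1 = n, reg s 2 = 1
    & forall a, a < L -> memory s a = nth 0 (encode l) a].

(** This is the obligation of [head] and [body], whereas [same_data] describes the effect of the
    scan's own instructions. Register 7 may be overwritten by [body], as it is reloaded for each
    neighbour. *)
Definition same_ctrl s s' : Prop :=
  [seq reg s' r | r <- [:: 3; 4; 5; 6]] = [seq reg s r | r <- [:: 3; 4; 5; 6]].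

Definition same_data s s' : Prop :=
  memory s' = memory s /\
  forall r, r \notin [:: 3; 4; 5; 6; 7] -> reg s' r = reg s r.

Lemma same_data_ctrl s s' : same_data s s' -> ctrl s -> ctrl s'.
Proof. by case=> Em Er [c1 c2 c3]; split; rewrite ?Em ?Er. Qed.

Lemma same_data_trans s1 s2 s3 :
  same_data s1 s2 -> same_data s2 s3 -> same_data s1 s3.
Proof.
by move=> [E1 F1] [E2 F2]; split=> [|r rn]; rewrite ?E2 ?F2 // F1.
Qed.

Lemma same_data_step i r s : r \in [:: 3; 4; 5; 6; 7] ->
  (i = Const r (result i s)) \/ (exists a b, i = Add r a b) \/
     (exists a, i = Read r a) -> same_data s (step i s).
Proof.
move=> rn H; split; first by case: H => [->|[[a [b ->]]|[a ->]]].
move=> r' rn'; have E : (r' == r) = false by apply: contraNF rn' => /eqP ->.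
by case: H => [->|[[a [b ->]]|[a ->]]] /=; rewrite E.
Qed.

(** [Inv k E] refers to a moment when [head] has treated the first [k] rows and [body] the arcs in
    [E]; within row [i] the first argument is therefore already [i.+1]. *)
Variables (head body : program) (Inv : nat -> seq (nat * nat) -> state -> Prop).
Hypotheses (w_gt : L < w)
  (rows_lt : forall i u, u \in row i -> u < n)
  (Inv_data : forall i E s s', same_data s s' -> Inv i E s -> Inv i E s')
  (headP : forall i s, i < n -> ctrl s -> reg s 3 = i -> reg s 6 = deg i ->
     Inv i (arcs i) s ->
     wp w head (fun s' =>
       [/\ ctrl s', same_ctrl s s' & Inv i.+1 (arcs i) s']) s)
  (bodyP : forall i u E s, i < n -> u \in row i -> size E < L -> ctrl s ->
     reg s 3 = i -> reg s 6 = deg i -> reg s 7 = u -> Inv i.+1 E s ->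
     wp w body (fun s' =>
       [/\ ctrl s', same_ctrl s s' & Inv i.+1 (rcons E (i, u)) s']) s).

Lemma row_runs i j s : i < n -> j <= deg i -> ctrl s ->
    reg s 3 = i -> reg s 4 = (offset i + j).+1 -> reg s 5 = (offset i + deg i).+1 ->
    reg s 6 = deg i ->
    Inv i.+1 (arcs i ++ [seq (i, u) | u <- take j (row i)]) s ->
  runs w (WhileLt 4 5 (Seq (Instr (Read 7 4)) (Seq body (Instr (Add 4 4 2)))))
    s ((cost body + 3) * (deg i - j)).+1
    (fun s' => [/\ ctrl s', reg s' 3 = i, reg s' 4 = offset i.+1
                 & Inv i.+1 (arcs i.+1) s']).
Proof.
move=> lt_i; move Ek: (deg i - j) => k; elim: k j s Ek => [|k IH] j s Ek le_j cs s3 s4 s5 s6 Is.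
  have Ej : j = deg i by apply/eqP; rewrite eqn_leq le_j -subn_eq0 Ek.
  rewrite muln0; apply: runs_while_stop; first by rewrite s4 s5 Ej.
  by split; rewrite // ?offsetS ?arcsS ?s4 ?Ej // -[row i]take_size -/(deg i) -Ej.
have lt_j : j < deg i by lia.
have c3 := let: And3 _ _ c := cs in c.
have off_lt := offset_lt lt_i.
set u := nth 0 (row i) j.
have u_row : u \in row i by apply: mem_nth.
apply: (runs_weaken (t := (cost body + 2 + ((cost body + 3) * k).+1).+1)
  (P := fun s' => [/\ ctrl s', reg s' 3 = i, reg s' 4 = offset i.+1
                 & Inv i.+1 (arcs i.+1) s'])) => //; last by lia.
pose s1 := step (Read 7 4) s.
have mem_s4 : memory s (reg s 4) = u by rewrite s4 c3 ?encode_row //; lia.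
have d1 : same_data s s1 by apply: (same_data_step (r := 7)) => //; right; right; exists 4.
apply: (runs_while_loop (P := fun s' => [/\ ctrl s', reg s' 3 = i,
   reg s' 4 = (offset i + j.+1).+1, reg s' 5 = (offset i + deg i).+1
   & reg s' 6 = deg i /\ Inv i.+1 (arcs i ++ [seq (i, u) | u <- take j.+1 (row i)]) s'])).
- by rewrite s4 s5; lia.
- apply: (runs_weaken (t := 1 + (cost body + 1))) => [||s' H]; [|lia|exact: H].
  apply: (runs_seq (P := eq s1)).
    apply: (@wp_runs w (Instr _)); split=> //=.
    by rewrite mem_s4; have := rows_lt u_row; move: w_gt; rewrite size_encode; lia.
  move=> _ <-; apply: runs_seq.
    have lt_E : size (arcs i ++ [seq (i, u) | u <- take j (row i)]) < L.
      rewrite size_cat size_map size_take -/(deg i) lt_j.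
      by move: off_lt; rewrite /offset; lia.
    apply/wp_runs/(bodyP lt_i u_row lt_E (same_data_ctrl d1 cs)) => //.
    exact: Inv_data d1 Is.
  move=> s2 [c2 e2 I2]; case: e2 => e3 e4 e5 e6.
  apply: (@wp_runs w (Instr _)); split.
    by case: c2 => _ /= -> _; rewrite e4 /= s4; lia.
  have d2 : same_data s2 (step (Add 4 4 2) s2).
    by apply: (same_data_step (r := 4)) => //; right; left; exists 4, 2.
  split; try by rewrite /= ?e3 ?e5 ?e6.
  + by case: c2 => _ /= -> _; rewrite e4 /= s4; lia.
  + split; first by rewrite /= e6.
    apply: (Inv_data d2); move: I2.
    by rewrite -cats1 -catA (take_nth 0) // map_rcons -cats1.
- move=> s' [c' s3' s4' s5' [s6' I']]; apply: IH I' => //; lia.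
Qed.

(** Time is charged to memory cells, not to rows: a row of degree [d] fills [d + 1] cells, which
    makes the nested loops linear in [L]. The 9 adds six steps of overhead per row and three per
    neighbour. *)
Lemma rows_runs_from i s : i <= n -> ctrl s ->
    reg s 3 = i -> reg s 4 = offset i -> Inv i (arcs i) s ->
  runs w (if for_rows head body is Seq _ (Seq _ p) then p else Skip) s
    ((cost head + cost body + 9) * (L - offset i)).+1
    (fun s' => [/\ ctrl s', reg s' 4 = L & Inv n (arcs n) s']).
Proof.
rewrite -[L in L - _]offset_size.
move Ek: (n - i) => k; elim: k i s Ek => [|k IH] i s Ek le_i cs s3 s4 Is /=.
  have Ei : i = n by lia.
  rewrite Ei subnn muln0; apply: runs_while_stop; first by case: cs => ->; rewrite s3 Ei.
  by split=> //; rewrite ?s4 -?Ei // Ei offset_size.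
have lt_i : i < n by lia.
have c3 := let: And3 _ _ c := cs in c.
have off_lt := offset_lt lt_i.
apply: (runs_weaken
  (t := ((1 + (1 + (cost head + (1 + (((cost body + 3) * (deg i - 0)).+1 + 1))))) +
         ((cost head + cost body + 9) * (offset n - offset i.+1)).+1).+1)
  (P := fun s' => [/\ ctrl s', reg s' 4 = L & Inv n (arcs n) s'])) => //; last first.
  have : offset i.+1 <= offset n by apply: offset_mono.
  by rewrite offsetS; nia.
pose s1 := step (Read 6 4) s; pose s2 := step (Add 4 4 2) s1.
have d1 : same_data s s1 by apply: (same_data_step (r := 6)) => //; right; right; exists 4.
have d2 : same_data s s2.
  apply: same_data_trans d1 _; apply: (same_data_step (r := 4)) => //.
  by right; left; exists 4, 2.
have deg_i : memory s (reg s 4) = deg i by rewrite s4 c3 ?encode_deg //; lia.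
have s2_4 : reg s2 4 = (offset i).+1 by case: cs => _ /= -> _; rewrite s4 addn1.
have s2_6 : reg s2 6 = deg i by rewrite -deg_i.
apply: (runs_while_loop (P := fun s' => [/\ ctrl s', reg s' 3 = i.+1,
   reg s' 4 = offset i.+1 & Inv i.+1 (arcs i.+1) s'])).
- by case: cs => -> _ _; rewrite s3.
- apply: (runs_seq (P := eq s1)).
    by apply: (@wp_runs w (Instr _)); split=> //=; rewrite deg_i; lia.
  move=> _ <-; apply: (runs_seq (P := eq s2)).
    by apply: (@wp_runs w (Instr _)); split=> //; move: s2_4 => /= ->; lia.
  move=> _ <-; apply: runs_seq.
    apply/wp_runs/(headP lt_i (same_data_ctrl d2 cs)) => //.
    exact: Inv_data d2 Is.
  move=> s3' [c3' [e3 e4 e5 e6] I3]; pose s4' := step (Add 5 4 6) s3'.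
  have d4 : same_data s3' s4'.
    by apply: (same_data_step (r := 5)) => //; right; left; exists 4, 6.
  have s4'_5 : reg s4' 5 = (offset i + deg i).+1.
    by move: e4 e6 => /= -> ->; move: s2_4 s2_6 => /= -> ->; lia.
  apply: (runs_seq (P := eq s4')).
    by apply: (@wp_runs w (Instr _)); split=> //; move: s4'_5 => /= ->; lia.
  move=> _ <-; apply: (runs_seq (P := fun s' => [/\ ctrl s', reg s' 3 = i,
    reg s' 4 = offset i.+1 & Inv i.+1 (arcs i.+1) s'])).
    apply: row_runs => //.
    + by rewrite /= e3.
    + by move: e4 s2_4 => /= -> ->; rewrite addn0.
    + by move: e6 s2_6 => /= -> ->.
    + by rewrite take0 cats0; apply: Inv_data d4 I3.
  move=> s5 [c5 r3 r4 I5]; have d5 : same_data s5 (step (Add 3 3 2) s5).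
    by apply: (same_data_step (r := 3)) => //; right; left; exists 3, 2.
  have r3' : reg (step (Add 3 3 2) s5) 3 = i.+1.
    by case: c5 => _ /= -> _; rewrite r3 addn1.
  apply: (@wp_runs w (Instr _)); split.
    by move: r3' => /= ->; move: off_lt; rewrite /offset; lia.
  by split; [apply: same_data_ctrl d5 c5 | | rewrite /= r4 | apply: Inv_data d5 I5].
- by move=> s' [c' r3 r4 I']; apply: IH; rewrite // subnS Ek.
Qed.

Lemma for_rows_runs s : ctrl s -> Inv 0 [::] s ->
  runs w (for_rows head body) s ((cost head + cost body + 9) * L)
    (fun s' => [/\ ctrl s', reg s' 4 = L & Inv n (arcs n) s']).
Proof.
move=> cs Is; pose s1 := step (Const 3 0) s; pose s2 := step (Const 4 1) s1.
have d1 : same_data s s1 by apply: (same_data_step (r := 3)) => //; left.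
have d2 : same_data s s2.
  by apply: same_data_trans d1 _; apply: (same_data_step (r := 4)) => //; left.
have L0 : 0 < L by rewrite size_encode.
apply: (runs_weaken (t := 1 + (1 + ((cost head + cost body + 9) * (L - offset 0)).+1))
  (P := fun s' => [/\ ctrl s', reg s' 4 = L & Inv n (arcs n) s'])) => //; last first.
  (* [offset 0] is 1: the cell holding the number of vertices pays for the two initialisations and
     the final test. *)
  rewrite /offset /=; nia.
apply: (runs_seq (P := eq s1)).
  by apply: (@wp_runs w (Instr _)); split=> //=; lia.
move=> _ <-; apply: (runs_seq (P := eq s2)).
  by apply: (@wp_runs w (Instr _)); split=> //=; lia.
move=> _ <-; apply: rows_runs_from => //.
exact: Inv_data d2 Is.
Qed.
End Rows.

(** * The algorithm *)

Definition seqs (ps : seq program) : program := foldr Seq Skip ps.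

(** One scan both detects a universal vertex and finds a minimum degree. Adding register 8, which is
    0, copies a register. *)
Definition min_head : program := seqs
  [:: Instr (Add 13 6 2); Instr (Add 13 13 2);
      IfLt 1 13 (Instr (Const 0 1)) Skip;
      IfLt 6 11 (Seq (Instr (Add 11 6 8)) (Instr (Add 10 3 8))) Skip].

(** After a scan register 4 is the first address behind the input: the marks are placed there, and
    the degrees behind the marks. *)
Definition mark_min : program := seqs
  [:: Instr (Add 9 4 8); Instr (Add 15 9 1); Instr (Add 13 9 10);
      Instr (Write 13 2)].

(** The degrees are copied to an array so that the last scan finds the degree of a neighbour in
    constant time. *)
Definition mark_head : program := seqs
  [:: Instr (Add 13 15 3); Instr (Write 13 6)].

Definition mark_body : program :=
  IfLt 3 10 Skip (IfLt 10 3 Skip (Seq (Instr (Add 13 9 7)) (Instr (Write 13 2)))).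

(** Marks are 0 or 1, so one comparison tells whether the row's vertex is marked and its neighbour
    is not. *)
Definition if_crossing (p : program) : program := seqs
  [:: Instr (Add 13 9 3); Instr (Read 16 13);
      Instr (Add 13 9 7); Instr (Read 13 13); IfLt 13 16 p Skip].

Definition test_arc : program := seqs
  [:: Instr (Add 13 15 7); Instr (Read 13 13); Instr (Add 13 13 6);
      Instr (Add 13 13 2); Instr (Add 13 13 2); Instr (Add 17 1 12);
      IfLt 17 13 (Instr (Const 0 1)) Skip].

(** The empty graph is accepted at once. Register 11 starts at the number of vertices, which exceeds
    every degree. *)
Definition start : program := seqs
  [:: Instr (Read 1 0); Instr (Const 2 1); Instr (Add 11 1 8);
      IfLt 1 2 (Instr (Const 0 1)) Skip].

(* Registers: 0 answer, 1 number of vertices, 2 the constant 1, 8 the constant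
   0, 9 address of the marks of the closed neighbourhood of the vertex in
   register 10, which has the minimum degree (register 11), 12 number of arcs
   leaving the marked set, 15 address of the array of degrees. *)
Definition algorithm : program := seqs
  [:: start;
      for_rows min_head Skip;
      mark_min;
      for_rows mark_head mark_body;
      for_rows Skip (if_crossing (Instr (Add 12 12 2)));
      for_rows Skip (if_crossing test_arc)].

(** * Invariants of the scans and the total running time *)

Section Correctness.
Variables (l : seq (seq nat)) (w : nat).
Local Notation n := (size l).
Local Notation L := (size (encode l)).
Local Notation deg := (deg l).
Local Notation row := (row l).
Local Notation arcs := (arcs l).
Hypotheses (w_gt : 3 * L + 4 < w)
  (rows_lt : forall i u, u \in row i -> u < n)
  (deg_lt : forall i, i < n -> deg i < n).

Definition marked v u : bool := (u == v) || ((v, u) \in arcs n).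
Definition leaving v (x : nat * nat) : bool := marked v x.1 && ~~ marked v x.2.
Definition universal i : bool := n < deg i + 2.
Definition covering v (x : nat * nat) : bool :=
  leaving v x && (n + count (leaving v) (arcs n) < deg x.1 + deg x.2 + 2).
Definition minimal k v : Prop := v < k /\ forall i, i < k -> deg v <= deg i.

Let n_lt : n < L.
Proof. by rewrite size_encode; lia. Qed.

Let L_lt : L < w.
Proof. by lia. Qed.

(** The last disjunction separates the initial values, which persist for the empty graph, from a
    minimum actually found. The cells from [L] on must still be 0, because they become the initial
    marks. *)
Definition min_inv k (E : seq (nat * nat)) s : Prop :=
  [/\ (0 < reg s 0) = (n == 0) || has universal (iota 0 k),
      reg s 8 = 0 /\ reg s 12 = 0, forall a, L <= a -> memory s a = 0
    & [/\ k = 0, reg s 10 = 0 & reg s 11 = n] \/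
      (minimal k (reg s 10) /\ reg s 11 = deg (reg s 10))].

Lemma min_inv_data i E s s' : same_data s s' -> min_inv i E s -> min_inv i E s'.
Proof. by case=> Em Er; rewrite /min_inv !Er // Em. Qed.

Lemma min_headP i s : i < n -> ctrl l s -> reg s 3 = i -> reg s 6 = deg i ->
  min_inv i (arcs i) s ->
  wp w min_head (fun s' =>
    [/\ ctrl l s', same_ctrl s s' & min_inv i.+1 (arcs i) s']) s.
Proof.
move=> lt_i [c1 c2 c3] s3 s6 [acc [z8 z12] mem0 mn]; have d_lt := deg_lt lt_i.
have acc_i : (n == 0) || has universal (iota 0 i.+1) =
    (0 < reg s 0) || (n < deg i + 2).
  by rewrite acc -orbA -[i.+1]addn1 iotaD has_cat /= orbF.
have min_lt : deg i < reg s 11 -> minimal i.+1 i.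
  move=> lt_d; split=> // j; rewrite ltnS leq_eqVlt => /orP[/eqP -> // | lt_j].
  by case: mn => [[i0 _]|[[_ /(_ j lt_j)]]]; lia.
have min_ge : (deg i < reg s 11) = false ->
    minimal i.+1 (reg s 10) /\ reg s 11 = deg (reg s 10).
  move=> ge_d; case: mn => [[_ _ E]|[[lt_v v_min] E]]; first by lia.
  split=> //; split=> [|j]; first by lia.
  by rewrite ltnS leq_eqVlt => /orP[/eqP -> | /v_min //]; lia.
rewrite /= !c2 !s6 /=; split; first by lia.
split; first by lia.
rewrite c1 s3 z8 !addn0 -addnA.
case: ifP acc_i => univ_i acc_i; [split; first by lia|]; case: ifP => lt_d.
1,3: split; [lia | split; [lia|]].
all: rewrite /min_inv acc_i ?univ_i ?orbT ?orbF; split=> //=; split=> //.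
1,2: by right; split; first exact: min_lt.
all: by right; exact: min_ge.
Qed.

Definition mark_inv v (acc : bool) k (E : seq (nat * nat)) s : Prop :=
  [/\ (0 < reg s 0) = acc, [/\ reg s 9 = L, reg s 10 = v & reg s 15 = L + n],
      reg s 12 = 0,
      forall u, u < n -> memory s (L + u) = (u == v) || ((v, u) \in E)
    & forall j, j < k -> memory s (L + n + j) = deg j].

Lemma mark_inv_data v acc i E s s' :
  same_data s s' -> mark_inv v acc i E s -> mark_inv v acc i E s'.
Proof. by case=> Em Er; rewrite /mark_inv !Er // Em. Qed.

Lemma mark_headP v acc i s : i < n -> ctrl l s -> reg s 3 = i ->
  reg s 6 = deg i -> mark_inv v acc i (arcs i) s ->
  wp w mark_head (fun s' =>
    [/\ ctrl l s', same_ctrl s s' & mark_inv v acc i.+1 (arcs i) s']) s.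
Proof.
move=> lt_i [c1 c2 c3] s3 s6 [s0 [s9 s10 s15] s12 marks degs].
have d_lt := deg_lt lt_i.
rewrite /= s3 s6 s15; split; first by lia.
split; first by lia.
split=> //; first by split=> //= a lt_a; case: eqP => [|_]; [lia | exact: c3].
split=> //= [u lt_u | j].
  by case: eqP => [|_]; [lia | exact: marks].
rewrite ltnS leq_eqVlt eqn_add2l; case: eqP => [-> //|_] /= lt_j; exact: degs.
Qed.

Lemma mark_bodyP v acc i u E s : i < n -> u \in row i -> size E < L -> ctrl l s ->
  reg s 3 = i -> reg s 6 = deg i -> reg s 7 = u -> mark_inv v acc i.+1 E s ->
  wp w mark_body (fun s' =>
    [/\ ctrl l s', same_ctrl s s' & mark_inv v acc i.+1 (rcons E (i, u)) s']) s.
Proof.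
move=> lt_i u_row _ cs s3 s6 s7 [s0 [s9 s10 s15] s12 marks degs].
have skip : i != v -> mark_inv v acc i.+1 (rcons E (i, u)) s.
  move=> iv; split=> // t lt_t; rewrite marks // mem_rcons inE.
  by rewrite xpair_eqE [v == i]eq_sym (negPf iv).
have lt_u := rows_lt u_row; case: (cs) => c1 c2 c3.
rewrite /= !s3 !s10; case: ltnP => [lt_iv | le_vi]; first by split=> //; apply: skip; lia.
case: ltnP => [lt_vi | le_iv]; first by split=> //; apply: skip; lia.
have Ev : i = v by lia.
rewrite /= s9 s7 c2; split; first by lia.
split; first by lia.
split=> //; first by split=> //= a lt_a; case: eqP => [|_]; [lia | exact: c3].
split=> //= [t lt_t | j lt_j].
  rewrite eqn_add2l mem_rcons inE xpair_eqE -Ev eqxx /= marks // Ev.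
  by case: (t == u); rewrite ?orbT.
by case: eqP => [|_]; [lia | exact: degs].
Qed.

(** * The two scans that leave the memory unchanged *)

Section Counting.
Variables (v : nat) (acc : bool) (m : nat -> nat).
Hypotheses (m_input : forall a, a < L -> m a = nth 0 (encode l) a)
  (m_marks : forall u, u < n -> m (L + u) = marked v u)
  (m_degs : forall i, i < n -> m (L + n + i) = deg i).

Let mark_lt u : marked v u < w.
Proof. by case: (marked v u); lia. Qed.

Definition count_inv (k : nat) (E : seq (nat * nat)) s : Prop :=
  [/\ (0 < reg s 0) = acc, reg s 9 = L /\ reg s 15 = L + n, memory s = m
    & reg s 12 = count (leaving v) E].

Lemma count_inv_data i E s s' :
  same_data s s' -> count_inv i E s -> count_inv i E s'.
Proof. by case=> Em Er; rewrite /count_inv !Er // Em. Qed.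

Lemma count_bodyP i u E s : i < n -> u \in row i -> size E < L -> ctrl l s ->
  reg s 3 = i -> reg s 6 = deg i -> reg s 7 = u -> count_inv i.+1 E s ->
  wp w (if_crossing (Instr (Add 12 12 2))) (fun s' =>
    [/\ ctrl l s', same_ctrl s s' & count_inv i.+1 (rcons E (i, u)) s']) s.
Proof.
move=> lt_i u_row lt_E [c1 c2 c3] s3 s6 s7 [s0 [s9 s15] sm s12].
have lt_u := rows_lt u_row; have := count_size (leaving v) E.
rewrite /= !s3 !s9 !s7 !sm !s12 !c2 !m_marks // => le_E.
do 4 (split; first by [exact: mark_lt | lia]).
have -> : (marked v u < marked v i) = leaving v (i, u).
  by rewrite /leaving; do 2 case: marked.
case: ifP => lv; [split; first by lia|]; split=> //.
  by split=> //=; rewrite -cats1 count_cat /= lv.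
by split=> //=; rewrite -cats1 count_cat /= lv s12 !addn0.
Qed.

Definition test_inv (k : nat) (E : seq (nat * nat)) s : Prop :=
  [/\ (0 < reg s 0) = acc || has (covering v) E, reg s 9 = L /\ reg s 15 = L + n,
      memory s = m & reg s 12 = count (leaving v) (arcs n)].

Lemma test_inv_data i E s s' :
  same_data s s' -> test_inv i E s -> test_inv i E s'.
Proof. by case=> Em Er; rewrite /test_inv !Er // Em. Qed.

Lemma test_bodyP i u E s : i < n -> u \in row i -> size E < L -> ctrl l s ->
  reg s 3 = i -> reg s 6 = deg i -> reg s 7 = u -> test_inv i.+1 E s ->
  wp w (if_crossing test_arc) (fun s' =>
    [/\ ctrl l s', same_ctrl s s' & test_inv i.+1 (rcons E (i, u)) s']) s.
Proof.
move=> lt_i u_row lt_E [c1 c2 c3] s3 s6 s7 [s0 [s9 s15] sm s12].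
have lt_u := rows_lt u_row; have lt_di := deg_lt lt_i; have lt_du := deg_lt lt_u.
have le_count : count (leaving v) (arcs n) < L.
  rewrite -(offset_size l) /offset; have := count_size (leaving v) (arcs n); lia.
rewrite /= !s3 !s9 !s7 !s6 !s15 !sm !s12 !c1 !c2 !m_marks // m_degs //.
do 4 (split; first by [exact: mark_lt | lia]).
have -> : (marked v u < marked v i) = leaving v (i, u).
  by rewrite /leaving; do 2 case: marked.
have has_rcons : has (covering v) (rcons E (i, u)) =
    has (covering v) E || covering v (i, u).
  by rewrite -cats1 has_cat /= orbF.
case: ifP => lv; last first.
  by split=> //; split=> //=; rewrite has_rcons s0 /covering lv /= orbF.
do 6 (split; first by lia).
have -> : (n + count (leaving v) (arcs n) < deg u + deg i + 1 + 1) = covering v (i, u).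
  by rewrite /covering lv /= -addnA [deg u + _]addnC.
case: ifP => cov; [split; first by lia|]; split=> //; split=> //=.
  by rewrite has_rcons cov !orbT.
by rewrite has_rcons s0 cov orbF.
Qed.

End Counting.

Lemma startP : wp w start (fun s => ctrl l s /\ min_inv 0 [::] s)
  (init_state (encode l)).
Proof.
have mem0 a : L <= a -> nth 0 (encode l) a = 0 by apply: nth_default.
rewrite /=; do 3 (split; first by lia).
rewrite addn0 ltnS leqn0; case: ifP => n0; [split; first by lia|].
all: by split=> //; split=> //=; rewrite ?n0 //; left.
Qed.

Lemma mark_minP s : ctrl l s -> reg s 4 = L -> min_inv n (arcs n) s ->
  wp w mark_min (fun s' => ctrl l s' /\
    exists2 v, n = 0 \/ minimal n v &
      mark_inv v ((n == 0) || has universal (iota 0 n)) 0 [::] s') s.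
Proof.
move=> [c1 c2 c3] s4 [s0 [z8 z12] mem0 mn].
(* The inequality is not strict because register 10 is 0 when the graph is empty; the mark is then
   still written behind the input. *)
have lt_v : reg s 10 <= n by case: mn => [[_ -> _]|[[/ltnW]]].
rewrite /= s4 z8 c1 c2 !addn0; do 4 (split; first by lia).
split; first by split=> //= a lt_a; case: eqP => [|_]; [lia | exact: c3].
exists (reg s 10); first by case: mn => [[-> _ _]|[]]; [left | right].
split=> //= u _; rewrite eqn_add2l orbF mem0 ?leq_addr //.
Qed.

Lemma algorithm_runs :
  runs w algorithm (init_state (encode l)) (200 * L) (fun s =>
    exists2 v, n = 0 \/ minimal n v &
    accepting s = [|| n == 0, has universal (iota 0 n) | has (covering v) (arcs n)]).
Proof.
(* Four scans linear in [L] and constant work around them; 200 is a generous bound for the sum. *)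
have cost_le : cost start + ((cost min_head + 1 + 9) * L + (cost mark_min +
    ((cost mark_head + cost mark_body + 9) * L +
    ((1 + cost (if_crossing (Instr (Add 12 12 2))) + 9) * L +
    ((1 + cost (if_crossing test_arc) + 9) * L + 1))))) <= 200 * L.
  by rewrite /cost -/cost /=; lia.
apply: runs_weaken cost_le (fun s' H => H).
apply: (runs_seq (wp_runs startP)) => s1 [c1 inv1].
apply: (runs_seq (for_rows_runs (Inv := min_inv) L_lt rows_lt min_inv_data min_headP _ c1 inv1)).
  by move=> i u E s *; split.
move=> s2 [c2 r4 inv2]; apply: (runs_seq (wp_runs (mark_minP c2 r4 inv2))).
move=> s3 [c3 [v v_min inv3]].
apply: (runs_seq (for_rows_runs (Inv := mark_inv v _) L_lt rows_lt (@mark_inv_data v _)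
  (@mark_headP v _) (@mark_bodyP v _) c3 inv3)).
move=> s4 [c4 _ [s0 [s9 s10 s15] s12 marks degs]].
have [_ _ m_input] := c4.
have inv4 : count_inv v ((n == 0) || has universal (iota 0 n)) (memory s4) 0 [::] s4 by [].
apply: (runs_seq (for_rows_runs (Inv := count_inv v _ _) L_lt rows_lt
  (@count_inv_data v _ _) _ (@count_bodyP v _ _ m_input marks) c4 inv4)).
  by move=> i s *; split.
move=> s5 [c5 _ [s0' [s9' s15'] sm' s12']].
have inv5 : test_inv v ((n == 0) || has universal (iota 0 n)) (memory s4) 0 [::] s5.
  by split=> //; rewrite orbF.
apply: (runs_seq (for_rows_runs (Inv := test_inv v _ _) L_lt rows_lt
  (@test_inv_data v _ _) _ (@test_bodyP v _ _ m_input marks degs) c5 inv5)).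
  by move=> i s *; split.
move=> s6 [_ _ [acc _ _ _]]; apply: (@wp_runs w Skip).
by exists v; rewrite // /accepting acc orbA.
Qed.
End Correctness.

(** * Adjacency lists *)

(** Only the two orientations of an edge have that edge as their unordered pair. *)
Lemma card_arcs_le (V : finType) (G : sgraph V) :
  #|[set u : V * V | edge G u.1 u.2]| <= 2 * #|edges G|.
Proof.
pose f (u : V * V) := [set u.1; u.2].
rewrite -sum1_card (partition_big f (mem (edges G))) /=; last first.
  by move=> u; rewrite inE => uG; apply/imsetP; exists u; rewrite // inE.
rewrite mulnC -sum_nat_const; apply: leq_sum => e /imsetP[[x y]]; rewrite inE /= => xy ->.
rewrite sum1dep_card; apply: leq_trans (_ : #|[set (x, y); (y, x)]| <= 2); last first.
  by rewrite cards2; case: eqP.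
apply/subset_leq_card/subsetP => -[a b]; rewrite !inE /f /= => /andP[ab /eqP E].
have := set21 a b; have := set22 a b; rewrite E !inE !xpair_eqE.
have := edge_neq ab => {E ab} ab /orP[] /eqP Eb /orP[] /eqP Ea.
all: by move: ab; rewrite Ea Eb !eqxx ?orbT.
Qed.

Section Adjacency.
Variables (l : seq (seq nat)) (G : sgraph 'I_(size l)).
Hypothesis adj : adjacency_lists G l.
Local Notation n := (size l).

Lemma row_perm (i : 'I_n) : perm_eq (row l i) [seq val j | j <- enum (nbrs G i)].
Proof.
have [_ /(_ i)] := adj; rewrite /row => /perm_trans; apply.
apply/perm_map/uniq_perm => [||j].
- exact/filter_uniq/enum_uniq.
- exact: enum_uniq.
by rewrite mem_filter !mem_enum !inE andbT.
Qed.

Lemma deg_card (i : 'I_n) : deg l i = #|nbrs G i|.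
Proof. by rewrite /deg (perm_size (row_perm i)) size_map cardE. Qed.

Lemma mem_row (i j : 'I_n) : (val j \in row l i) = edge G i j.
Proof.
by rewrite (perm_mem (row_perm i)) mem_map ?mem_enum ?inE //; apply: val_inj.
Qed.

Lemma row_lt i u : u \in row l i -> u < n.
Proof.
case: (ltnP i n) => [lt_i|le_i]; last by rewrite /row nth_default.
by rewrite (perm_mem (row_perm (Ordinal lt_i))) => /mapP[j _ ->]; exact: ltn_ord.
Qed.

Lemma deg_lt i : i < n -> deg l i < n.
Proof.
move=> lt_i; rewrite (deg_card (Ordinal lt_i)) -[X in _ < X]card_ord.
apply/proper_card/properP; split; first exact/subsetP.
by exists (Ordinal lt_i) => //; rewrite inE edge_irrefl.
Qed.

(** Rows are free of repetitions and arcs from different rows differ, so counts over the scanned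
    list become cardinalities of sets of ordered pairs. *)
Lemma arcs_perm : perm_eq (arcs l n)
  [seq (val u.1, val u.2) | u <- enum [set u : 'I_n * 'I_n | edge G u.1 u.2]].
Proof.
apply: uniq_perm.
- suff uniq_arcs k : k <= n -> uniq (arcs l k) by apply: uniq_arcs.
  elim: k => // k IH lt_k.
  rewrite arcsS cat_uniq (IH (ltnW lt_k)) map_inj_uniq => [|? ? []//].
  rewrite (perm_uniq (row_perm (Ordinal lt_k))) map_inj_uniq ?enum_uniq ?andbT; last exact: val_inj.
  by apply/hasPn => _ /mapP[u _ ->]; rewrite /= mem_arcs ltnn.
- rewrite map_inj_uniq ?enum_uniq // => -[a b] [c d] [] /= ? ?.
  by congr (_, _); apply: val_inj.
move=> [i u]; rewrite mem_arcs; apply/andP/mapP => [[lt_i u_row]|[[a b]]].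
  have lt_u := row_lt u_row; exists (Ordinal lt_i, Ordinal lt_u) => //.
  by rewrite mem_enum inE /= -mem_row.
by rewrite mem_enum inE /= => ab [-> ->]; rewrite mem_row.
Qed.

Lemma size_arcs : size (arcs l n) <= 2 * #|edges G|.
Proof. by rewrite (perm_size arcs_perm) size_map -cardE card_arcs_le. Qed.

Lemma mem_marked (v u : 'I_n) : marked l v u = (u \in v |: nbrs G v).
Proof. by rewrite /marked mem_arcs ltn_ord mem_row !inE. Qed.

Lemma count_leaving (v : 'I_n) :
  count (leaving l v) (arcs l n) = #|crossing G (v |: nbrs G v)|.
Proof.
move/permP: arcs_perm => ->; rewrite count_map -sum1_count big_enum_cond sum1dep_card.
by apply: eq_card => u; rewrite !inE /leaving /= !mem_marked !inE.
Qed.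

Lemma has_universalP :
  has (universal l) (iota 0 n) <-> exists a, #|'I_n| < #|nbrs G a| + 2.
Proof.
split=> [/hasP[i] | [a big]].
  rewrite mem_iota /= add0n => lt_i; rewrite /universal (deg_card (Ordinal lt_i)).
  by exists (Ordinal lt_i); rewrite card_ord.
apply/hasP; exists (val a); first by rewrite mem_iota /= add0n.
by rewrite /universal deg_card -[X in X < _]card_ord.
Qed.

Lemma has_coveringP (v : 'I_n) : let A := v |: nbrs G v in
  has (covering l v) (arcs l n) <-> exists a b, [/\ a \in A, b \notin A, edge G a b &
     #|'I_n| + #|crossing G A| < #|nbrs G a| + #|nbrs G b| + 2].
Proof.
rewrite card_ord /= -count_leaving; split=> [/hasP[[i u]] | [a [b [aA bA ab big]]]].
  rewrite mem_arcs => /andP[lt_i u_row]; have lt_u := row_lt u_row.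
  pose a := Ordinal lt_i; pose b := Ordinal lt_u.
  rewrite /covering /leaving /= -[i]/(val a) -[u]/(val b) !deg_card !mem_marked.
  by case/andP=> /andP[aA bA] big; exists a, b; rewrite aA bA -mem_row.
apply/hasP; exists (val a, val b); first by rewrite mem_arcs ltn_ord mem_row.
by rewrite /covering /leaving /= !deg_card !mem_marked aA bA.
Qed.

Lemma minimal_nbrs (v : 'I_n) : minimal l n v -> forall u, #|nbrs G v| <= #|nbrs G u|.
Proof. by move=> [_ v_min] u; rewrite -!deg_card; apply: v_min. Qed.

Lemma empty_admissible : n = 0 -> admissible 2 G.
Proof.
move=> n0; have noV : 'I_n -> False by rewrite n0 => -[].
exists G; split; last by move=> x; case: (noV x).
by split=> //; split=> [x|[|x c]] //; case: (noV x).
Qed.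

Lemma algorithm_correct v : zero_two_graph G -> n = 0 \/ minimal l n v ->
  [|| n == 0, has (universal l) (iota 0 n) | has (covering l v) (arcs l n)] <->
  admissible 2 G.
Proof.
move=> G02 v_min; have [n0|n_pos] := eqVneq n 0.
  by split=> // _; apply: empty_admissible.
case: v_min => [n0|v_min]; first by rewrite n0 in n_pos.
have lt_v : v < n by case: v_min.
have critP := admissible2P G02 (@minimal_nbrs (Ordinal lt_v) v_min).
split=> [/= /orP[/has_universalP | /(has_coveringP (Ordinal lt_v))] ok | /critP[|] ok].
- by apply/critP; left.
- by apply/critP; right.
- by rewrite /=; apply/orP; left; apply/has_universalP.
- by rewrite /=; apply/orP; right; apply/(has_coveringP (Ordinal lt_v)).
Qed.
End Adjacency.

Theorem theorem7 :
  exists (p : program) (c k : nat),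
    forall (n : nat) (G : sgraph 'I_n) (l : seq (seq nat)),
      zero_two_graph G -> adjacency_lists G l ->
      let m := #|edges G| in
      exists (s : state) (t : nat),
        [/\ exec ((n + m + 2) ^ k) p (init_state (encode l)) s t,
            t <= c * (n + m + 1)
          & accepting s <-> admissible 2 G].
Proof.
(* The time is at most [200 * L] with [L <= n + 2 * m + 1], hence the factor 400. For words,
   [3 * L + 4] is below [8 * x] with [x = n + m + 2], and [8 * x <= x ^ 4] because [x >= 2]. *)
exists algorithm, 400, 4 => n G l G02 adj m.
have En := adj.1; move: n En G G02 @m adj => _ <- G G02 m adj.
have L_le : size (encode l) <= size l + 2 * m + 1.
  by rewrite -offset_size /offset; have := size_arcs adj; rewrite -/m; lia.
have w_gt : 3 * size (encode l) + 4 < (size l + m + 2) ^ 4.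
  have x2 : 2 <= size l + m + 2 by lia.
  move: x2 L_le; set x := size l + m + 2 => x2 L_le.
  have : 2 ^ 3 * x <= x ^ 3 * x by rewrite leq_mul2r leq_exp2r ?x2 ?orbT.
  by rewrite -expnSr; rewrite /x; lia.
have [s [t [ex le_t [v v_min acc]]]] := algorithm_runs w_gt (row_lt adj) (deg_lt adj).
exists s, t; split=> //; first by apply: leq_trans le_t _; lia.
by rewrite acc; apply: algorithm_correct.
Qed.
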